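(* Let $(\Omega,\mu)$ be an atomless finite measure space and let $p(\cdot),q(\cdot)$ be exponents on $\Omega$ with $q(\cdot)<p(\cdot)$ $\mu$-a.e. The following are equivalent: (1) $\int_0^{\mu(\Omega)} a^{\left(\frac{p\,q}{p-q}\right)^*(x)}\,dx<\infty$ for every $a>1$. (2) The inclusion $L^{p(\cdot)}(\mu)\hookrightarrow L^{q(\cdot)}(\mu)$ is $L$-weakly compact. (3) The inclusion $L^{p(\cdot)}(\mu)\hookrightarrow L^{q(\cdot)}(\mu)$ is $M$-weakly compact. (4) The inclusion $L^{p(\cdot)}(\mu)\hookrightarrow L^{q(\cdot)}(\mu)$ is disjointly strictly singular. (5) The restriction of the inclusion $L^{p(\cdot)}(\mu)\hookrightarrow L^{q(\cdot)}(\mu)$ to any closed subspace spanned by a disjoint sequence of the form $\left(\frac{\chi_{E_n}}{\mu(E_n)^{1/p(t)}}\right)_n$ is not an isomorphism. (6) $\lim_{x\to\mu(\Omega)^-}(\mu(\Omega)-x)^{\left(\frac{p-q}{p\,q}\right)^*(x)}=0$.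
   Context: An exponent on $\Omega$ is a real measurable function $p$ with $1\le p(t)<\infty$ (possibly unbounded). The variable Lebesgue space $L^{p(\cdot)}(\mu)$ is the space of all (classes of) real measurable $f$ on $\Omega$ such that $\rho_{p(\cdot)}(f/r)<\infty$ for some $r>0$, where $\rho_{p(\cdot)}(f)=\int_\Omega |f(t)|^{p(t)}d\mu$, with the Luxemburg norm $\|f\|_{p(\cdot)}=\inf\{r>0:\rho_{p(\cdot)}(f/r)\le 1\}$. On a finite measure space, $q(\cdot)\le p(\cdot)$ a.e. implies that $L^{p(\cdot)}(\mu)\subset L^{q(\cdot)}(\mu)$ with continuous inclusion. For measurable $f$ on $\Omega$, the distribution function is $\mu_f(s)=\mu(\{t\in\Omega:|f(t)|>s\})$ and the decreasing rearrangement is $f^*(x)=\inf\{s\in[0,\infty):\mu_f(s)\le x\}$ for $x\in[0,\mu(\Omega))$. ''Isomorphism'' means isomorphism onto the image (bounded below). An operator $T:E\to F$ from a Banach lattice $E$ to a Banach space $F$ is disjointly strictly singular (DSS) if there is no normalized pairwise disjoint sequence $(f_n)$ in $E$ such that the restriction of $T$ to the closed linear span $[f_n]$ is an isomorphism. $T$ is $M$-weakly compact if $\lim_n\|Tf_n\|_F=0$ for every norm bounded disjoint sequence $(f_n)$ in $E$. If $E,F$ are Banach function lattices on $(\Omega,\mu)$, $T$ is $L$-weakly compact if $\lim_{n\to\infty}\sup_{f\in B_E}\|(Tf)\chi_{A_n}\|_F=0$ for every sequence $(A_n)$ of measurable sets with $\chi_{A_n}\to 0$ $\mu$-a.e.,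 where $B_E$ is the unit ball of $E$. In (5), $(E_n)$ is an (infinite) sequence of pairwise disjoint measurable sets of positive measure, and $\frac{\chi_{E_n}}{\mu(E_n)^{1/p(t)}}$ denotes the function $t\mapsto \chi_{E_n}(t)\,\mu(E_n)^{-1/p(t)}$. *)

(* Defs.v *)
From HB Require Import structures.
From mathcomp Require Import all_boot all_order all_algebra.
From mathcomp Require Import all_classical all_reals all_analysis.

Set Implicit Arguments.
Unset Strict Implicit.
Unset Printing Implicit Defensive.

Import Order.TTheory GRing.Theory Num.Theory.
Import numFieldNormedType.Exports.

Local Open Scope classical_set_scope.
Local Open Scope ring_scope.

Definition atomless (d : measure_display) (T : measurableType d) (R : realType)
    (mu : {measure set T -> \bar R}) : Prop :=
  forall A : set T, measurable A -> (0 < mu A)%E ->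
    exists B : set T,
      [/\ measurable B, B `<=` A, (0 < mu B)%E & (mu B < mu A)%E].

Definition distribution_fun (d : measure_display) (T : measurableType d)
    (R : realType) (mu : {measure set T -> \bar R}) (f : T -> R) (s : R) : \bar R :=
  mu [set t | s < `|f t|].

(* Extended-real valued: the infimum of the empty set is +oo, which for x in
   [0, mu(Omega)) can only occur at x = 0 (when f is essentially unbounded). *)
Definition rearrangement (d : measure_display) (T : measurableType d)
    (R : realType) (mu : {measure set T -> \bar R}) (f : T -> R) (x : R) : \bar R :=
  ereal_inf [set s%:E | s in
    [set s : R | 0 <= s /\ (distribution_fun mu f s <= x%:E)%E]].

(* a ^ y for a real base a > 0 and an extended real exponent y. *)
Definition powRe (R : realType) (a : R) (y : \bar R) : \bar R :=
  expeR (y * (ln a)%:E)%E.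

Lemma powRe_EFin (R : realType) (a y : R) :
  0 < a -> powRe a y%:E = (a `^ y)%:E.
Proof. by move=> a0; rewrite /powRe -EFinM /= /powR gt_eqF. Qed.

(* A (semi)normed space of real functions; classes modulo a.e. equality are
   handled through their representatives.  The norm is extended-real valued so
   that it is meaningful on all functions T -> R. *)
Record fun_space (T : Type) (R : realType) := FunSpace {
  fcarrier : set (T -> R) ;
  fnorm : (T -> R) -> \bar R }.

Definition disjoint_seq (d : measure_display) (T : measurableType d)
    (R : realType) (mu : {measure set T -> \bar R}) (f : nat -> T -> R) : Prop :=
  forall m n : nat, m <> n ->
    {ae mu, forall t, Num.min `|f m t| `|f n t| = 0}.

Definition closed_span (T : Type) (R : realType) (E : fun_space T R)
    (f : nat -> T -> R) : set (T -> R) :=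
  [set g | fcarrier E g /\
    forall e : R, 0 < e -> exists (n : nat) (a : nat -> R),
      (fnorm E (fun t => g t - \sum_(i < n) a i * f i t)%R < e%:E)%E].

Definition isomorphism_on (T : Type) (R : realType) (E F : fun_space T R)
    (S : (T -> R) -> (T -> R)) (V : set (T -> R)) : Prop :=
  exists2 c : R, 0 < c &
    forall g, V g -> (c%:E * fnorm E g <= fnorm F (S g))%E.

Definition disjointly_strictly_singular (d : measure_display)
    (T : measurableType d) (R : realType) (mu : {measure set T -> \bar R})
    (E F : fun_space T R) (S : (T -> R) -> (T -> R)) : Prop :=
  ~ exists f : nat -> T -> R,
    [/\ forall n, fcarrier E (f n),
        forall n, fnorm E (f n) = 1%E,
        disjoint_seq mu f
      & isomorphism_on E F S (closed_span E f)].

Definition M_weakly_compact (d : measure_display)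
    (T : measurableType d) (R : realType) (mu : {measure set T -> \bar R})
    (E F : fun_space T R) (S : (T -> R) -> (T -> R)) : Prop :=
  forall f : nat -> T -> R,
    (forall n, fcarrier E (f n)) ->
    (exists M : R, forall n, (fnorm E (f n) <= M%:E)%E) ->
    disjoint_seq mu f ->
    fnorm F (S (f n)) @[n --> \oo] --> 0%E.

Definition L_weakly_compact (d : measure_display)
    (T : measurableType d) (R : realType) (mu : {measure set T -> \bar R})
    (E F : fun_space T R) (S : (T -> R) -> (T -> R)) : Prop :=
  forall A : nat -> set T,
    (forall n, measurable (A n)) ->
    {ae mu, forall t, (\1_(A n) t : R) @[n --> \oo] --> (0 : R)} ->
    ereal_sup [set fnorm F (fun t => S f t * \1_(A n) t) | f in
        [set f | fcarrier E f /\ (fnorm E f <= 1)%E]]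
      @[n --> \oo] --> 0%E.

Definition exponent (d : measure_display) (T : measurableType d)
    (R : realType) (p : T -> R) : Prop :=
  measurable_fun setT p /\ forall t, 1 <= p t.

Definition modular (d : measure_display) (T : measurableType d)
    (R : realType) (mu : {measure set T -> \bar R}) (p f : T -> R) : \bar R :=
  (\int[mu]_t (`|f t| `^ p t)%:E)%E.

Definition luxemburg_norm (d : measure_display) (T : measurableType d)
    (R : realType) (mu : {measure set T -> \bar R}) (p f : T -> R) : \bar R :=
  ereal_inf [set r%:E | r in
    [set r : R | 0 < r /\ (modular mu p (fun t => f t / r)%R <= 1)%E]].

Definition varL (d : measure_display) (T : measurableType d)
    (R : realType) (mu : {measure set T -> \bar R}) (p : T -> R) : fun_space T R :=
  FunSpace
    [set f : T -> R | measurable_fun setT f /\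
       exists2 r : R, 0 < r & (modular mu p (fun t => f t / r)%R < +oo)%E]
    (luxemburg_norm mu p).

Definition normalized_indic (d : measure_display) (T : measurableType d)
    (R : realType) (mu : {measure set T -> \bar R}) (p : T -> R) (E : set T) : T -> R :=
  fun t => \1_E t * (fine (mu E)) `^ (- (p t)^-1).

(* Main.v *)
Require Import Defs.
From HB Require Import structures.
From mathcomp Require Import all_boot all_order all_algebra.
From mathcomp Require Import all_classical all_reals all_analysis.
From mathcomp Require Import measurable_realfun ring lra.

Set Implicit Arguments.
Unset Strict Implicit.
Unset Printing Implicit Defensive.

Import Order.TTheory GRing.Theory Num.Theory.
Import numFieldNormedType.Exports.

Local Open Scope classical_set_scope.
Local Open Scope ring_scope.

(** Put [r = p q / (p - q)], so that [1 / q = 1 / p + 1 / r].  All six conditions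
    express one fact: the distribution [mu(|r| > s)] decays faster than
    [a ^ - s] for every [a > 1] (predicate [exp_tail]).

    Rearrangements see the distribution only.  By Chebyshev's inequality,
    integrability of every [a ^ r^*] forces the tail
    ([rearrangement_exp_tail]); conversely the tail at base [2 a] bounds
    [a ^ r^*], and likewise [a ^ r] on the measure space, by a convergent
    geometric series ([exp_tail_rearrangement], [exp_tail_integral_lty]).
    Since [(p - q) / (p q) = 1 / r], the limit condition on
    [y ^ (1 / r)^*(m - y)] is again the tail, read at the level [s] with
    [a ^ - s = y] ([reciprocal_exp_tail], [exp_tail_reciprocal]).

    The tail makes the inclusion L-weakly compact: Young's inequality
    [(x c) ^ q <= x ^ p + c ^ r] splits the modular of [f chi_A / e] into a part
    controlled by the unit ball and the integral of [(4 / e) ^ r] over [A],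
    which is small by dominated convergence ([exp_tail_L_weakly_compact]).
    L-weak compactness applied to supports gives M-weak compactness, which sends
    normalized disjoint sequences to null sequences; hence disjoint strict
    singularity, in particular on the normalized indicators.

    To return to the tail, suppose that it fails.  Then there are disjoint layers
    [E_n] of the form [s_n < |r| <= s_n.+1] with [mu(E_n) >= a ^ - s_n / 2]
    ([not_exp_tail_layers]).  On them [mu(E_n) ^ (1 / r)] is bounded below, that
    is, the indicators normalized for [p] are comparable with those normalized
    for [q].  If [f = \sum a_n chi_(E_n) / mu(E_n) ^ (1 / p)] has [q]-norm less
    than [c l], then every [|a_n|] is at most [l], so
    [(|a_n| / l) ^ p <= (|a_n| / l) ^ q] and the [p]-norm is at most [l]: the
    inclusion is an isomorphism on the span ([isomorphism_normalized_indic]). *)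

(** * Integration and extended reals *)

Section integral_tools.
Context d (T : measurableType d) (R : realType).

(** The integral of a nonnegative function is a supremum over simple minorants,
    hence monotone on arbitrary functions.  This is how composites with a
    rearrangement are compared with explicit integrands. *)
Lemma ge0_le_integral_nomeas (mu : {measure set T -> \bar R}) (D : set T)
    (f g : T -> \bar R) :
  (forall t, D t -> 0 <= f t)%E -> (forall t, D t -> f t <= g t)%E ->
  (\int[mu]_(t in D) f t <= \int[mu]_(t in D) g t)%E.
Proof.
move=> f0 fg.
have g0 t : D t -> (0 <= g t)%E.
  by move=> Dt; apply: le_trans (fg _ Dt); exact: f0.
rewrite !ge0_integralE//.
apply: ge_ereal_sup => _ [h hf <-]; apply: ereal_sup_ubound; exists h => //= t.
apply: le_trans (hf t) _; rewrite /patch; case: ifPn => // Dt.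
by apply: fg; exact: set_mem Dt.
Qed.

Lemma measurable_fun_powR (f p : T -> R) :
  measurable_fun setT f -> measurable_fun setT p ->
  measurable_fun setT (fun t => f t `^ p t).
Proof.
move=> mf mp; rewrite /powR; apply: measurable_fun_ifT.
- exact: measurable_fun_eqr.
- apply: (@measurableT_comp _ _ _ _ _ _ (fun b : bool => b%:R : R)) => //.
  exact: measurable_fun_eqr.
- apply: measurableT_comp => //; apply: measurable_funM => //.
  exact: measurableT_comp.
Qed.

Lemma measurable_fun_inv (f : T -> R) : measurable_fun setT f ->
  measurable_fun setT (fun t => (f t)^-1).
Proof.
move=> mf; rewrite (_ : (fun t => _) = fun t => f t * (`|f t| `^ (-1)) ^+ 2).
  apply: measurable_funM => //; apply: measurable_funX.
  by apply: measurable_fun_powR => //; exact: measurableT_comp.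
(* [x^-1 = x * (|x|^-1)^2] holds at [0] as well *)
apply/funext => t; rewrite powR_inv1// exprVn real_normK ?num_real//.
have [->|ft0] := eqVneq (f t) 0; first by rewrite invr0 mul0r.
by rewrite expr2 invfM mulrA mulfV// mul1r.
Qed.

Lemma ae_le_measure (mu : {measure set T -> \bar R}) (A B : set T) :
  measurable A -> measurable B -> {ae mu, forall t, A t -> B t} ->
  (mu A <= mu B)%E.
Proof.
move=> mA mB AB; rewrite -[A]setIT -[B]setIT -!integral_indic//.
apply: ae_ge0_le_integral => //; try by move=> t _; rewrite lee_fin.
- by apply/measurable_EFinP; exact: measurable_indic.
- by apply/measurable_EFinP; exact: measurable_indic.
apply: filterS AB => t AB _; rewrite lee_fin !indicE ler_nat.
by have [/set_mem/AB/mem_set ->|//] := boolP (t \in A).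
Qed.

End integral_tools.

Lemma lee_fin_above (R : realType) (x y : \bar R) : (-oo < y)%E ->
  (forall r : R, (y < r%:E)%E -> (x <= r%:E)%E) -> (x <= y)%E.
Proof.
case: y => [y _ h|_ _|//]; last by rewrite leey.
apply/lee_addgt0Pr => e e0; rewrite -EFinD; apply: h.
by rewrite lte_fin ltrDl.
Qed.

Lemma ge0_cvge0P (R : realType) (I : Type) (F : set_system I)
    (FF : Filter F) (u : I -> \bar R) :
  (\forall i \near F, (0 <= u i)%E) ->
  (forall e : R, 0 < e -> \forall i \near F, (u i <= e%:E)%E) <->
  (u i @[i --> F] --> 0%E).
Proof.
move=> u0; split=> [h A|uF e e0]; last first.
  apply: (uF [set z | (z <= e%:E)%E]).
  exists e => //= r /=; rewrite sub0r normrN => re.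
  by rewrite lee_fin (le_trans (ler_norm _))// ltW.
move=> [e /= e0 eA]; have e20 : 0 < e / 2 by rewrite divr_gt0.
have := h _ e20; rewrite nbhs_filterE /=.
apply: filterS2 u0 => i + + /=; case: (u i) => [r|//|//].
rewrite !lee_fin => r0 re; apply: eA => /=; rewrite sub0r normrN ger0_norm//.
by rewrite (le_lt_trans re)// ltr_pdivrMr// ltr_pMr// ltr1n.
Qed.

(** * The Luxemburg norm of a variable exponent *)

Section luxemburg.
Context d (T : measurableType d) (R : realType).
Variables (mu : {measure set T -> \bar R}) (p : T -> R).
Hypothesis p_exp : exponent p.

Lemma exponent_gt0 t : 0 < p t.
Proof. by case: p_exp => _ /(_ t); apply: lt_le_trans. Qed.

Lemma measurable_modular (f : T -> R) : measurable_fun setT f ->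
  measurable_fun setT (fun t => (`|f t| `^ p t)%:E).
Proof.
move=> mf; apply/measurable_EFinP; apply: measurable_fun_powR.
  exact: measurableT_comp.
by case: p_exp.
Qed.

Lemma modular_ge0 (f : T -> R) : (0 <= modular mu p f)%E.
Proof. by apply: integral_ge0 => t _; rewrite lee_fin powR_ge0. Qed.

Lemma le_modular (f g : T -> R) : measurable_fun setT f ->
  measurable_fun setT g -> {ae mu, forall t, `|f t| <= `|g t|} ->
  (modular mu p f <= modular mu p g)%E.
Proof.
move=> mf mg fg; apply: ae_ge0_le_integral => //.
- exact: measurable_modular.
- exact: measurable_modular.
apply: filterS fg => t fgt _; rewrite lee_fin; apply: ge0_ler_powR; rewrite ?nnegrE//.
by rewrite ltW// exponent_gt0.
Qed.

(** Holds because [k ^ p <= k] for [k <= 1 <= p].  It stands in for the convexity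
    of the modular wherever constants do not matter. *)
Lemma modularZ_le (k : R) (f : T -> R) : 0 <= k <= 1 -> measurable_fun setT f ->
  (modular mu p (fun t => k * f t)%R <= k%:E * modular mu p f)%E.
Proof.
move=> /andP[k0 k1] mf; rewrite -ge0_integralZl//; last first.
- exact: measurable_modular.
apply: ge0_le_integral => //.
- by apply: measurable_modular; exact: measurable_funM.
- by apply: measurable_funeM; exact: measurable_modular.
move=> t _; rewrite -EFinM lee_fin normrM (ger0_norm k0).
have [->|kn0] := eqVneq k 0.
  by rewrite !mul0r powR0// gt_eqF// exponent_gt0.
apply: ge1r_powRZ => //; first by rewrite lt0r kn0 k0 k1.
by case: p_exp => _ /(_ t).
Qed.

Local Notation norm := (luxemburg_norm mu p).

Lemma luxemburg_norm_ge0 f : (0 <= norm f)%E.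
Proof.
by apply: le_ereal_inf_tmp => _ [r [r0 _] <-]; rewrite lee_fin ltW.
Qed.

Lemma luxemburg_norm_le (f : T -> R) (r : R) : 0 < r ->
  (modular mu p (fun t => f t / r)%R <= 1)%E -> (norm f <= r%:E)%E.
Proof. by move=> r0 h; apply: ereal_inf_lbound; exists r. Qed.

Lemma luxemburg_norm_lt (f : T -> R) (r : R) : measurable_fun setT f ->
  (norm f < r%:E)%E -> 0 < r /\ (modular mu p (fun t => f t / r)%R <= 1)%E.
Proof.
move=> mf /ereal_inf_ltP[_ [s [s0 hs] <-]]; rewrite lte_fin => sr.
have r0 : 0 < r by exact: lt_trans sr.
split; first exact: r0.
have -> : (fun t => f t / r) = (fun t => s / r * (f t / s)).
  by apply/funext => t; field; rewrite !gt_eqF.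
have sr01 : 0 <= s / r <= 1.
  by rewrite divr_ge0 ?(ltW s0) ?(ltW r0)//= ler_pdivrMr// mul1r ltW.
apply: le_trans (modularZ_le sr01 _) _; first exact: measurable_funM.
rewrite -[leRHS]mul1e; apply: lee_pmul => //.
- by rewrite lee_fin; case/andP: sr01.
- exact: modular_ge0.
- by rewrite lee_fin; case/andP: sr01.
Qed.

Lemma luxemburg_norm_le_above (f : T -> R) (r : R) :
  (forall s, r < s -> (norm f <= s%:E)%E) -> (norm f <= r%:E)%E.
Proof.
by move=> h; apply: lee_fin_above => [|s]; rewrite ?ltNyr// lte_fin; exact: h.
Qed.

Lemma le_luxemburg_norm (f g : T -> R) : measurable_fun setT f ->
  measurable_fun setT g -> {ae mu, forall t, `|f t| <= `|g t|} ->
  (norm f <= norm g)%E.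
Proof.
move=> mf mg fg; apply: lee_fin_above => [|r gr].
  by apply: lt_le_trans (luxemburg_norm_ge0 g); rewrite ltNyr.
have [r0 gr1] := luxemburg_norm_lt mg gr.
apply: (luxemburg_norm_le r0); apply: le_trans gr1; apply: le_modular.
- exact: measurable_funM.
- exact: measurable_funM.
by apply: filterS fg => t fgt; rewrite !normrM ler_wpM2r.
Qed.

Lemma luxemburg_normZ_le (k r : R) (f : T -> R) : 0 < k ->
  measurable_fun setT f -> (norm f <= r%:E)%E ->
  (norm (fun t => k * f t)%R <= (k * r)%:E)%E.
Proof.
move=> k0 mf fr; apply: luxemburg_norm_le_above => s; rewrite mulrC -ltr_pdivlMr// => rs.
have [s0 h] := luxemburg_norm_lt mf (le_lt_trans fr (rs : (r%:E < (s / k)%:E)%E)).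
apply: luxemburg_norm_le; first by move: s0; rewrite pmulr_lgt0// invr_gt0.
have -> // : (fun t => k * f t / s) = (fun t => f t / (s / k)).
by apply/funext => t; rewrite invf_div mulrCA mulrA.
Qed.

(** A quasi-triangle inequality:
    [((x + y) / 2) ^ p <= max x y ^ p <= x ^ p + y ^ p] bounds the modular of
    [(f + g) / (2 r)] by [2], and one more factor [2] brings it down to [1]. *)
Lemma luxemburg_normD_le (r : R) (f g : T -> R) : measurable_fun setT f ->
  measurable_fun setT g -> (norm f < r%:E)%E -> (norm g < r%:E)%E ->
  (norm (fun t => f t + g t)%R <= (4 * r)%:E)%E.
Proof.
move=> mf mg /(luxemburg_norm_lt mf)[r0 fr] /(luxemburg_norm_lt mg)[_ gr].
have mfr : measurable_fun setT (fun t => f t / r) by exact: measurable_funM.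
have mgr : measurable_fun setT (fun t => g t / r) by exact: measurable_funM.
apply: luxemburg_norm_le; first by rewrite mulr_gt0.
pose h t := 2^-1 * (f t / r) + 2^-1 * (g t / r).
have mh : measurable_fun setT h by apply: measurable_funD; exact: measurable_funM.
have -> : (fun t => (f t + g t) / (4 * r)) = (fun t => 2^-1 * h t).
  by apply/funext => t; rewrite /h; field; rewrite gt_eqF.
apply: le_trans (modularZ_le _ mh) _.
  by rewrite invr_ge0 ler0n/= invf_le1// ler1n.
suff h2 : (modular mu p h <= 2%:E)%E.
  by rewrite muleC lee_pdivrMr// mul1e.
apply: (@le_trans _ _ (modular mu p (fun t => f t / r)%R +
                       modular mu p (fun t => g t / r)%R)%E); last first.
  by rewrite -[2]/(1 + 1) EFinD; exact: leeD fr gr.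
rewrite /modular -ge0_integralD//; last 2 first.
- exact: measurable_modular.
- exact: measurable_modular.
apply: ge0_le_integral => //.
- exact: measurable_modular.
- by apply: emeasurable_funD; exact: measurable_modular.
move=> t _; rewrite -EFinD lee_fin /h.
set x := f t / r; set y := g t / r.
have p0 : 0 <= p t by rewrite ltW// exponent_gt0.
have hxy z : `|x| <= z -> `|y| <= z -> `|2^-1 * x + 2^-1 * y| <= z.
  move=> xz yz; rewrite -mulrDr normrM ger0_norm ?invr_ge0// mulrC ler_pdivrMr//.
  by rewrite mulr_natr mulr2n (le_trans (ler_normD _ _))// lerD.
have [xy|/ltW yx] := leP `|x| `|y|.
- apply: le_trans (ge0_ler_powR p0 _ _ (hxy `|y| _ _)) _; rewrite ?nnegrE//.
  by rewrite lerDr powR_ge0.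
- apply: le_trans (ge0_ler_powR p0 _ _ (hxy `|x| _ _)) _; rewrite ?nnegrE//.
  by rewrite lerDl powR_ge0.
Qed.

End luxemburg.

(** * Exponential tails *)

(** If a function is at most [b ^ n] off a set of measure [O((2 b) ^ - n)], for
    every [n], it is dominated by [1 + \sum_n b ^ n.+1 \1_(A n)], whose integral
    is a geometric series.  It serves both for [c ^ |r|] on the measure space
    itself and for its rearranged version on an interval. *)
Lemma integral_exp_tail_lty d (T : measurableType d) (R : realType)
    (mu : {measure set T -> \bar R}) (D : set T) (b C : R) (A : nat -> set T)
    (F : T -> \bar R) :
  measurable D -> (mu D < +oo)%E -> 1 <= b -> 0 <= C ->
  (forall n, measurable (A n)) ->
  (forall n, mu (A n) <= (C / (2 * b) ^+ n)%:E)%E ->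
  (forall t, D t -> (0 <= F t)%E) ->
  (forall n t, D t -> ~ A n t -> (F t <= (b ^+ n)%:E)%E) ->
  (\int[mu]_(t in D) F t < +oo)%E.
Proof.
move=> mD Dfin b1 C0 mA Atail F0 FA.
have b0 : 0 < b by exact: lt_le_trans b1.
pose u n t : \bar R := (b ^+ n.+1 * \1_(A n) t)%:E.
have u0 n t : (0 <= u n t)%E.
  by rewrite lee_fin mulr_ge0// exprn_ge0// ltW.
have mu_ n : measurable_fun D (u n).
  by apply/measurable_EFinP; apply: measurable_funM => //; apply: measurable_indic.
pose G t : \bar R := (1 + \sum_(n <oo) u n t)%E.
have usum0 t : (0 <= \sum_(n <oo) u n t)%E.
  exact: nneseries_ge0.
have ule n t : A n t -> ((b ^+ n.+1)%:E <= \sum_(k <oo) u k t)%E.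
  move=> At; apply: le_trans (nneseries_lim_ge n.+1 _) => //.
  rewrite big_nat_recr//= -[leLHS]add0e; apply: leeD.
    exact: sume_ge0.
  by rewrite /u lee_fin indicE mem_set// mulr1.
have FG t : D t -> (F t <= G t)%E.
  move=> Dt; have [[n nA]|allA] := pselect (exists n, ~ A n t); last first.
    have -> : G t = +oo%E; last by rewrite leey.
    apply/eqyP => M M0.
    apply: (@le_trans _ _ (\sum_(0 <= k < (Num.truncn M).+1) u k t)%E); last first.
      by apply: le_trans (nneseries_lim_ge _ _) _ => //; rewrite leeDr.
    apply: (@le_trans _ _ (\sum_(0 <= k < (Num.truncn M).+1) 1%:E)%E); last first.
      apply: lee_sum => k _; rewrite lee_fin indicE mem_set ?mulr1 ?exprn_ege1//.
      by apply: contrapT => nA; apply: allA; exists k.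
    rewrite sumEFin lee_fin big_const_nat subn0 iter_addr addr0.
    by rewrite ltW// truncnS_gt.
  have exn : exists n, t \notin A n by exists n; rewrite notin_setE.
  case: (ex_minnP exn) => -[|k]; rewrite notin_setE => kA minA.
    by apply: le_trans (FA _ _ Dt kA) _; rewrite expr0 leeDl.
  apply: le_trans (FA _ _ Dt kA) _.
  apply: le_trans (ule k t _) _; last by rewrite leeDr.
  apply: contrapT => nAk; have := minA k; rewrite notin_setE => /(_ nAk).
  by rewrite ltnn.
apply: le_lt_trans (ge0_le_integral_nomeas mu F0 FG) _.
rewrite ge0_integralD//; last by apply: ge0_emeasurable_sum.
rewrite integral_cst// mul1e integral_nneseries//.
apply: lte_add_pinfty => //.
apply: (@le_lt_trans _ _ (\sum_(n <oo) (0 + (2 * b * C / (2 ^ n.+1)%:R)%:E))%E).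
  apply: lee_nneseries => [n _ _|n _]; first exact: integral_ge0.
  have -> : (\int[mu]_(t in D) u n t =
      (b ^+ n.+1)%:E * \int[mu]_(t in D) (\1_(A n) t)%:E)%E.
    rewrite -ge0_integralZl//.
    - by apply/measurable_EFinP; exact: measurable_indic.
    - by rewrite lee_fin exprn_ge0// ltW.
  rewrite integral_indic// add0e.
  apply: (@le_trans _ _ ((b ^+ n.+1)%:E * (C / (2 * b) ^+ n)%:E)%E).
    apply: lee_wpmul2l; first by rewrite lee_fin exprn_ge0// ltW.
    by apply: le_trans (Atail n); apply: le_measure; rewrite ?inE//; exact: measurableI.
  rewrite -EFinM lee_fin natrX !exprS exprMn.
  rewrite le_eqVlt; apply/orP; left; apply/eqP; field.
  by rewrite !expf_neq0// gt_eqF.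
apply: le_lt_trans (epsilon_trick _ _ _) _ => //.
  by rewrite !mulr_ge0// ltW.
by rewrite eseries0// add0e ltry.
Qed.

Section powRe_monotone.
Context (R : realType).

Lemma powRe_ge0 (a : R) (y : \bar R) : (0 <= powRe a y)%E.
Proof. exact: expeR_ge0. Qed.

Lemma ler_powRe (a : R) (x y : \bar R) : 1 <= a ->
  (x <= y)%E -> (powRe a x <= powRe a y)%E.
Proof.
move=> a1 xy; rewrite /powRe lee_expeR; apply: lee_wpmul2r => //.
by rewrite lee_fin ln_ge0.
Qed.

Lemma ger_powRe (a : R) (x y : \bar R) : 0 < a <= 1 ->
  (x <= y)%E -> (powRe a y <= powRe a x)%E.
Proof.
move=> /andP[a0 a1] xy; rewrite /powRe lee_expeR -[ln a]opprK EFinN !muleN leeN2.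
by apply: lee_wpmul2r => //; rewrite lee_fin oppr_ge0 ln_le0.
Qed.

End powRe_monotone.

Lemma lebesgue_measure_itv0 (R : realType) (v : R) : 0 <= v ->
  lebesgue_measure (`[0%R, v[%classic : set R) = v%:E.
Proof.
rewrite lebesgue_measure_itv/= lte_fin le_eqVlt => /orP[/eqP <-|->].
  by rewrite ltxx.
by rewrite sube0.
Qed.

(** The common meaning of the six conditions, for [f = p q / (p - q)]. *)
Definition exp_tail d (T : measurableType d) (R : realType)
    (mu : {measure set T -> \bar R}) (f : T -> R) : Prop :=
  forall a : R, 1 < a -> exists2 C : R, 0 <= C &
    forall s, 0 <= s -> (distribution_fun mu f s <= (C * a `^ (- s))%:E)%E.

Section tail.
Context d (T : measurableType d) (R : realType).
Variables (mu : {finite_measure set T -> \bar R}) (f : T -> R).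
Hypothesis mf : measurable_fun setT f.

Local Notation m := (fine (mu setT)).
Local Notation distr := (distribution_fun mu f).

Lemma measure_fin A : measurable A -> (mu A = (fine (mu A))%:E)%E.
Proof. by move=> mA; rewrite fineK// fin_num_measure. Qed.

Lemma measurable_gt_abs (s : R) : measurable [set t | s < `|f t|].
Proof.
rewrite -[X in measurable X]setTI; apply: (@measurable_fun_ltr _ _ _ setT) => //.
exact: measurableT_comp.
Qed.

Lemma le_distribution_fun (s s' : R) : s <= s' -> (distr s' <= distr s)%E.
Proof.
move=> ss'; apply: le_measure; rewrite ?inE; [exact: measurable_gt_abs..|].
by move=> t /=; apply: le_lt_trans.
Qed.

Lemma rearrangement_le (s x : R) : 0 <= s -> (distr s <= x%:E)%E ->
  (rearrangement mu f x <= s%:E)%E.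
Proof. by move=> s0 h; apply: ereal_inf_lbound; exists s. Qed.

Lemma le_rearrangement (s x : R) : (x%:E < distr s)%E ->
  (s%:E <= rearrangement mu f x)%E.
Proof.
move=> xs; apply: le_ereal_inf_tmp => _ [s' [s'0 s'x] <-].
rewrite lee_fin leNgt; apply/negP => /ltW/le_distribution_fun ss'.
by have := lt_le_trans xs (le_trans ss' s'x); rewrite ltxx.
Qed.

(** For the series to converge at base [c], the tail is used at base [2 c]. *)
Lemma exp_tail_integral_lty (c : R) : exp_tail mu f -> 1 <= c ->
  (\int[mu]_t (c `^ `|f t|)%:E < +oo)%E.
Proof.
move=> tail c1; have c0 : 0 < c by exact: lt_le_trans c1.
have [|C C0 hC] := tail (2 * c); first by lra.
apply: (@integral_exp_tail_lty _ _ _ mu setT c C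
  (fun n => [set t | n%:R < `|f t|])) => //.
- by rewrite -ge0_fin_numE// fin_num_measure.
- by move=> n; exact: measurable_gt_abs.
- move=> n; apply: le_trans (hC n%:R _) _ => //.
  by rewrite lee_fin powRN powR_mulrn// mulr_ge0// ltW.
- by move=> t _; rewrite lee_fin powR_ge0.
- move=> n t _ /negP; rewrite -leNgt => fn.
  by rewrite lee_fin -(powR_mulrn n (ltW c0)); exact: ler_powR.
Qed.

(** [f^* <= n] outside [ [0, mu(|f| > n)[ ], whose length is the tail of [f]. *)
Lemma exp_tail_rearrangement (a : R) : exp_tail mu f -> 1 < a ->
  (\int[lebesgue_measure]_(x in `[0%R, m[) powRe a (rearrangement mu f x) < +oo)%E.
Proof.
move=> tail a1; have a0 : 0 < a by exact: lt_trans a1.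
have [|C C0 hC] := tail (2 * a); first by lra.
pose v n := fine (distr n%:R).
have vE n : distr n%:R = (v n)%:E by apply: measure_fin; exact: measurable_gt_abs.
apply: (@integral_exp_tail_lty _ _ _ lebesgue_measure _ a C
  (fun n => `[0, v n[%classic)) => //.
- by rewrite [X in (X < _)%E](lebesgue_measure_itv0 (fine_ge0 _)) ?ltry.
- exact: ltW.
- move=> n; rewrite [X in (X <= _)%E](lebesgue_measure_itv0 (fine_ge0 _))//.
  have := hC n%:R (ler0n _ _); rewrite vE lee_fin powRN powR_mulrn//.
  by rewrite mulr_ge0// ltW.
- by move=> x _; exact: powRe_ge0.
- move=> n x /=; rewrite !in_itv/= => /andP[x0 xm] /negP.
  rewrite x0/= -leNgt => vx.
  rewrite -(powR_mulrn n (ltW a0)) -powRe_EFin//; apply: ler_powRe; first exact: ltW.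
  by apply: rearrangement_le => //; rewrite vE lee_fin.
Qed.

(** Chebyshev's inequality on the rearranged side: [f^*] is at least [s] on
    [ [0, mu(|f| > s)[ ]. *)
Lemma rearrangement_exp_tail :
  (forall a : R, 1 < a -> (\int[lebesgue_measure]_(x in `[0%R, m[)
     powRe a (rearrangement mu f x) < +oo)%E) ->
  exp_tail mu f.
Proof.
move=> fin a a1; have a0 : 0 < a by exact: lt_trans a1.
have := fin _ a1; set I := integral _ _ _ => Ioo.
have I0 : (0 <= I)%E by apply: integral_ge0 => x _; exact: powRe_ge0.
exists (fine I) => [|s s0]; first exact: fine_ge0.
have mgt := measurable_gt_abs s.
pose v := fine (distr s).
have vE : distr s = v%:E by exact: measure_fin.
have v0 : 0 <= v by rewrite fine_ge0.
have vm : v <= m.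
  by rewrite -lee_fin -measure_fin// -measure_fin// le_measure ?inE.
rewrite vE lee_fin powRN ler_pdivlMr ?powR_gt0//.
rewrite -lee_fin fineK; last by rewrite ge0_fin_numE.
have -> : ((v * a `^ s)%:E =
    \int[lebesgue_measure]_(x in `[0%R, m[) (a `^ s * \1_(`[0%R, v[) x)%:E)%E.
  under eq_integral do rewrite EFinM.
  rewrite ge0_integralZl//; last 2 first.
  - by apply/measurable_EFinP; exact: measurable_indic.
  - by rewrite lee_fin powR_ge0.
  rewrite integral_indic//= setIidl; last first.
    by move=> x /=; rewrite !in_itv/= => /andP[-> xv]; exact: lt_le_trans vm.
  rewrite [X in (_ * X)%E](_ : _ = v%:E) ?EFinM 1?muleC//.
  exact: lebesgue_measure_itv0.
apply: ge0_le_integral_nomeas => x _; first by rewrite lee_fin mulr_ge0 ?powR_ge0.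
rewrite indicE; case: (boolP (x \in _)) => [|_]; last by rewrite mulr0 powRe_ge0.
rewrite mulr1 inE/= in_itv/= => /andP[x0 xv].
rewrite -powRe_EFin//; apply: ler_powRe; first exact: ltW.
by apply: le_rearrangement; rewrite vE lte_fin.
Qed.

End tail.

(** * Rearrangement of the reciprocal *)

Section reciprocal.
Context d (T : measurableType d) (R : realType).
Variables (mu : {finite_measure set T -> \bar R}) (f g : T -> R).
Hypothesis mf : measurable_fun setT f.
Hypothesis gf : forall t, g t = (f t)^-1.
Hypothesis f_neq0 : {ae mu, forall t, f t != 0}.

Local Notation m := (fine (mu setT)).

Let mg : measurable_fun setT g.
Proof.
rewrite (_ : g = fun t => (f t)^-1); last exact/funext.
exact: measurable_fun_inv.
Qed.

Let mu_setC (A : set T) : measurable A -> (mu (~` A) = (m - fine (mu A))%:E)%E.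
Proof.
move=> mA; rewrite -setTD measureD//; last first.
  by rewrite -ge0_fin_numE// fin_num_measure.
by rewrite setTI EFinB -!measure_fin.
Qed.

(** With [y = m - x], smallness of [y ^ g^* (m - y)] says that [g] is below
    [c / ln (1 / y)], i.e. [|f|] above [ln (1 / y) / c], only on a set of measure
    less than [y]: this is an exponential tail for [f]. *)
Lemma reciprocal_exp_tail :
  powRe (m - x) (rearrangement mu g x) @[x --> m^'-] --> 0%E ->
  exp_tail mu f.
Proof.
have pow0 : \forall x \near m^'-, (0 <= powRe (m - x) (rearrangement mu g x))%E.
  by apply: nearW => x; exact: powRe_ge0.
move=> /(ge0_cvge0P _ pow0) h a a1; have a0 : 0 < a by exact: lt_trans a1.
have ia1 : a^-1 < 1 by rewrite invf_lt1.
have ia0 : 0 < a^-1 by rewrite invr_gt0.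
have [|del /= del0 hdel] := h (a^-1 / 2); first by rewrite divr_gt0.
have m0 : 0 <= m by rewrite fine_ge0.
exists (1 + m + m / del); first by rewrite !addr_ge0// divr_ge0// ltW.
move=> s; have mgt := measurable_gt_abs mf s.
have mum : fine (mu [set t | s < `|f t|]) <= m.
  by rewrite -lee_fin -!measure_fin// le_measure ?inE.
rewrite /distribution_fun measure_fin// lee_fin le_eqVlt => /orP[/eqP se|s0].
  by rewrite -{}se in mum *; rewrite oppr0 powRr0 mulr1 (le_trans mum)//
    addrAC lerDr addr_ge0// divr_ge0// ltW.
set y := a `^ (- s); have y0 : 0 < y by rewrite powR_gt0.
have y1 : y <= 1.
  by rewrite -[leRHS](powRr0 a); apply: ler_powR; rewrite ?oppr_le0 ltW.
(* levels [s] too small for the limit to say anything: absorbed in the constant *)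
have [ydel|ydel] := ltP y del; last first.
  apply: le_trans mum _; rewrite mulrDl.
  apply: (@le_trans _ _ (m / del * y)).
    by rewrite -[leLHS]mulr1 -mulrA ler_wpM2l// mulrC ler_pdivlMr// mul1r.
  by rewrite lerDr mulr_ge0// ?addr_ge0// ltW.
suff muy : fine (mu [set t | s < `|f t|]) <= y.
  apply: le_trans muy _; rewrite ler_peMl ?(ltW y0)// -addrA lerDl.
  by rewrite addr_ge0// divr_ge0// ltW.
rewrite leNgt; apply/negP => ymu.
have gs : (rearrangement mu g (m - y) <= s^-1%:E)%E.
  apply: rearrangement_le; first by rewrite invr_ge0 ltW.
  apply: (@le_trans _ _ (mu (~` [set t | s < `|f t|]))).
    apply: le_measure; rewrite ?inE.
    - exact: measurable_gt_abs.
    - exact: measurableC.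
    move=> t /=; rewrite gf normfV => gt /=; apply/negP; rewrite -leNgt.
    rewrite leNgt; apply/negP => sf.
    by move: gt; rewrite ltNge => /negP; apply; rewrite lef_pV2 ?posrE ?ltW ?(lt_trans s0 sf).
  by rewrite mu_setC// lee_fin lerB// ltW.
have := hdel (m - y); rewrite /= opprB addrC subrK ger0_norm ?(ltW y0)//.
move=> /(_ ydel); rewrite ltrBlDr ltrDl => /(_ y0).
rewrite leNgt => /negP; apply.
apply: lt_le_trans (ger_powRe _ gs); last by rewrite y0.
rewrite powRe_EFin// lte_fin /y -powRrM mulNr mulfV ?gt_eqF// powR_inv1 ?ltW//.
by rewrite ltr_pdivrMr// ltr_pMr// ltr1n.
Qed.

(** If [g^*(m - y)] were below [K / ln (1 / y)], then [|f|] would exceed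
    [ln (1 / y) / K] on a set of measure at least [y]; the tail at base
    [expR (2 K)] bounds that measure by [C y ^ 2], which is less than [y]. *)
Lemma exp_tail_reciprocal : exp_tail mu f ->
  powRe (m - x) (rearrangement mu g x) @[x --> m^'-] --> 0%E.
Proof.
move=> tail; apply/ge0_cvge0P; first by apply: nearW => x; exact: powRe_ge0.
move=> e e0; pose e' := Num.min e 2^-1.
have e'0 : 0 < e' by rewrite lt_min e0 invr_gt0 ltr0n.
have e'1 : e' < 1 by rewrite gt_min [X in _ || X]invf_lt1 ?ltr1n// orbT.
pose K := - ln e'; have K0 : 0 < K by rewrite oppr_gt0 ln_lt0// e'0.
have [|C C0 hC] := tail (expR (2 * K)).
  by rewrite -expR0 ltr_expR mulr_gt0.
pose del := Num.min 1 (C + 1)^-1.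
have del0 : 0 < del by rewrite lt_min ltr01 invr_gt0 ltr_wpDl.
exists del => //= x /= + xm; rewrite ger0_norm ?subr_ge0 ?(ltW xm)// => ydel.
pose y := m - x; have y0 : 0 < y by rewrite subr_gt0.
have y1 : y < 1 by rewrite (lt_le_trans ydel)// ge_min lexx.
pose L := - ln y; have L0 : 0 < L by rewrite oppr_gt0 ln_lt0// y0.
have yE : y = expR (- L) by rewrite opprK lnK.
apply: (@le_trans _ _ (powRe y (K / L)%:E)); last first.
  rewrite powRe_EFin// lee_fin yE -expRM mulNr mulrC divfK ?gt_eqF// opprK lnK//.
  by rewrite ge_min lexx.
apply: ger_powRe; first by rewrite y0 ltW.
apply: le_ereal_inf_tmp => _ [s [s0 hs] <-]; rewrite lee_fin leNgt; apply/negP => sKL.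
have mgts := measurable_gt_abs mg s.
have mgtf := measurable_gt_abs mf (L / K).
have : (y%:E <= distribution_fun mu f (L / K))%E.
  apply: (@le_trans _ _ (mu (~` [set t | s < `|g t|]))).
    rewrite mu_setC// lee_fin /y lerB// -lee_fin -measure_fin//.
  apply: ae_le_measure => //; first exact: measurableC.
  apply: filterS f_neq0 => t ft0 /=; rewrite gf normfV => /negP.
  rewrite -leNgt => fs; rewrite -[L / K]invrK -(invrK `|f t|) ltf_pV2 ?posrE//.
  - by rewrite invf_div (le_lt_trans fs).
  - by rewrite invr_gt0 divr_gt0.
  - by rewrite invr_gt0 normr_gt0.
rewrite leNgt => /negP; apply.
apply: le_lt_trans (hC _ _) _; first by rewrite divr_ge0// ltW.
rewrite lte_fin -expRM.
have -> : 2 * K * - (L / K) = - L + - L by field; rewrite gt_eqF.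
rewrite expRD -yE mulrA gtr_pMl//.
apply: (@le_lt_trans _ _ (C / (C + 1))).
  rewrite ler_wpM2l// ltW// (lt_le_trans ydel)// ge_min lexx orbT//.
by rewrite ltr_pdivrMr ?mul1r ?ltrDl// ltr_wpDl.
Qed.

End reciprocal.

(** * Young's inequality and L-weak compactness *)

(** Young's inequality for the Hoelder triple [1 / q = 1 / p + 1 / r], read off
    from which of [x ^ p] and [c ^ r] is larger. *)
Lemma powR_young (R : realType) (x c p q : R) : 0 <= x -> 0 <= c ->
  0 < q -> q < p ->
  (x * c) `^ q <= x `^ p + c `^ (p * q / (p - q)).
Proof.
move=> x0 c0 q0 qp; have p0 : 0 < p by exact: lt_trans qp.
have pq0 : 0 < p - q by rewrite subr_gt0.
have pn0 := gt_eqF p0; have qn0 := gt_eqF q0; have pqn0 := gt_eqF pq0.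
have [cx|/ltW xc] := leP c (x `^ ((p - q) / q)).
  apply: (@le_trans _ _ (x `^ p)); last by rewrite lerDl powR_ge0.
  rewrite powRM// -[leRHS](_ : x `^ q * x `^ (p - q) = _); last first.
    by rewrite -powRD addrC subrK ?pn0.
  apply: ler_wpM2l; first exact: powR_ge0.
  rewrite -[p - q](divfK (negbT qn0)) powRrM.
  by apply: (ge0_ler_powR (ltW q0)); rewrite ?nnegrE ?powR_ge0.
apply: (@le_trans _ _ (c `^ (p * q / (p - q)))); last by rewrite lerDr powR_ge0.
have {}xc : x <= c `^ (q / (p - q)).
  rewrite -[leLHS](powRr1 x0).
  have -> : 1 = ((p - q) / q) * (q / (p - q)) by field; rewrite qn0 pqn0.
  rewrite powRrM; apply: ge0_ler_powR; rewrite ?nnegrE ?powR_ge0//.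
  by rewrite divr_ge0// ltW.
have -> : p * q / (p - q) = (q / (p - q) + 1) * q by field; rewrite pqn0.
rewrite powRrM; apply: (ge0_ler_powR (ltW q0)); rewrite ?nnegrE ?mulr_ge0 ?powR_ge0//.
rewrite powRD; last by rewrite gt_eqF// addr_gt0// divr_gt0.
by rewrite powRr1//; apply: ler_wpM2r.
Qed.

Section inclusion.
Context d (T : measurableType d) (R : realType).
Variables (mu : {finite_measure set T -> \bar R}) (p q : T -> R).
Hypotheses (p_exp : exponent p) (q_exp : exponent q).
Hypothesis q_lt_p : {ae mu, forall t, q t < p t}.

Let mp : measurable_fun setT p. Proof. by case: p_exp. Qed.
Let mq : measurable_fun setT q. Proof. by case: q_exp. Qed.

Local Notation r := (fun t => p t * q t / (p t - q t)).

Lemma measurable_holder_exponent : measurable_fun setT r.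
Proof.
apply: measurable_funM; first exact: measurable_funM.
by apply: measurable_fun_inv; exact: measurable_funB.
Qed.

Lemma holder_exponent_gt0 : {ae mu, forall t, 0 < r t}.
Proof.
apply: filterS q_lt_p => t qp.
by rewrite divr_gt0 ?subr_gt0// mulr_gt0//; exact: exponent_gt0.
Qed.

Let measurable_exp_holder (c : R) (A : set T) : measurable A ->
  measurable_fun setT (fun t => (c `^ `|r t| * \1_A t)%:E).
Proof.
move=> mA; apply/measurable_EFinP; apply: measurable_funM => //.
  apply: measurable_fun_powR => //; apply: measurableT_comp => //.
  exact: measurable_holder_exponent.
Qed.

Lemma modular_young (f : T -> R) (A : set T) (c : R) :
  measurable_fun setT f -> measurable A -> 0 <= c ->
  (modular mu q (fun t => f t * c * \1_A t)%R <=
   modular mu p f + \int[mu]_t (c `^ `|r t| * \1_A t)%:E)%E.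
Proof.
move=> mf mA c0; have mcr := measurable_exp_holder c mA.
have mfA : measurable_fun setT (fun t => f t * c * \1_A t).
  apply: measurable_funM; first exact: measurable_funM.
  exact: measurable_indic.
rewrite /modular -ge0_integralD//; last 2 first.
- exact: measurable_modular.
- by move=> t _; rewrite lee_fin mulr_ge0// powR_ge0.
apply: ae_ge0_le_integral => //.
- exact: measurable_modular.
- by move=> t _; rewrite -EFinD lee_fin addr_ge0 ?mulr_ge0 ?powR_ge0.
- by apply: emeasurable_funD => //; exact: measurable_modular.
have := holder_exponent_gt0; apply: filterS2 q_lt_p => t qp r0 _.
rewrite -EFinD lee_fin indicE; case: (t \in A); rewrite ?mulr1 ?mulr0.
  rewrite (ger0_norm (ltW r0)) normrM (ger0_norm c0).
  by apply: powR_young => //; exact: exponent_gt0.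
rewrite normr0 addr0 powR0 ?powR_ge0// gt_eqF//; exact: exponent_gt0.
Qed.

(** Young's inequality with [c = 1] costs an additive [mu setT] in the modular,
    which is absorbed by dividing by [1 + mu setT]. *)
Lemma luxemburg_norm_inclusion (f : T -> R) (s : R) : measurable_fun setT f ->
  (luxemburg_norm mu p f < s%:E)%E ->
  (luxemburg_norm mu q f <= ((1 + fine (mu setT)) * s)%:E)%E.
Proof.
move=> mf /(luxemburg_norm_lt p_exp mf)[s0 fs].
set k := 1 + _; have k1 : 1 <= k by rewrite lerDl fine_ge0.
have k0 : 0 < k by exact: lt_le_trans k1.
apply: luxemburg_norm_le; first by rewrite mulr_gt0.
have mfs : measurable_fun setT (fun t => f t / s) by exact: measurable_funM.
rewrite (_ : (fun t => _) = (fun t => k^-1 * (f t / s))); last first.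
  by apply/funext => t; field; rewrite !gt_eqF.
have k01 : 0 <= k^-1 <= 1 by rewrite invr_ge0 ltW//= invf_le1.
apply: le_trans (modularZ_le mu q_exp k01 mfs) _.
rewrite muleC lee_pdivrMr// mul1e.
have := modular_young mfs measurableT ler01.
rewrite (_ : (fun t => f t / s * 1 * _) = (fun t => f t / s)); last first.
  by apply/funext => t; rewrite indicT !mulr1.
move=> /le_trans; apply; rewrite /k EFinD; apply: leeD; first exact: fs.
rewrite (eq_integral (cst 1%E)) => [|t _]; last by rewrite powR1 indicT mulr1.
by rewrite integral_cst// mul1e -measure_fin.
Qed.

(** On the unit ball, [|f chi_A / e| ^ q <= |f / 4| ^ p + (4 / e) ^ r chi_A]; the
    first term integrates to at most [1 / 2] and the second is uniformly small
    in [f] by dominated convergence. *)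
Lemma exp_tail_L_weakly_compact : exp_tail mu r ->
  L_weakly_compact mu (varL mu p) (varL mu q) id.
Proof.
move=> tail A mA A0; apply/ge0_cvge0P.
  apply: nearW => n; apply: ereal_sup_ge.
  exists (luxemburg_norm mu q (fun t => 0 * \1_(A n) t)); last first.
    exact: luxemburg_norm_ge0.
  exists (fun=> 0) => //=; split; first split=> //.
    exists 1 => //; rewrite /modular; under eq_integral.
      by move=> t _; rewrite mul0r normr0 powR0 ?gt_eqF// ?exponent_gt0//; over.
    by rewrite integral0 ltry.
  apply: luxemburg_norm_le => //; rewrite /modular; under eq_integral.
    by move=> t _; rewrite mul0r normr0 powR0 ?gt_eqF// ?exponent_gt0//; over.
  by rewrite integral0.
(* the minimum with [1] makes the base [4 / e'] at least [1] *)
move=> e e0; pose e' := Num.min e 1.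
have e'0 : 0 < e' by rewrite lt_min e0 ltr01.
pose c := 4 / e'; have c1 : 1 <= c.
  by rewrite ler_pdivlMr// mul1r ge_min; apply/orP; right; rewrite ler1n.
pose u n t : \bar R := (c `^ `|r t| * \1_(A n) t)%:E.
pose G t : \bar R := (c `^ `|r t|)%:E.
have mr := measurable_holder_exponent.
have iG : mu.-integrable setT G.
  apply/integrableP; split.
    apply/measurable_EFinP; apply: measurable_fun_powR => //.
    exact: measurableT_comp.
  under eq_integral do rewrite gee0_abs ?lee_fin ?powR_ge0//.
  exact: exp_tail_integral_lty.
have [||||_ _] :=
    @dominated_convergence _ _ _ mu setT measurableT u (cst 0%E) G _ _ _ iG.
- by move=> n; exact: measurable_exp_holder.
- by [].
- apply: filterS A0 => t A0 _; apply: cvg_EFin; first exact: nearW.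
  by have := cvgMl_tmp (a := c `^ `|r t|) A0; rewrite mulr0; apply.
- apply: filterE => t n _; rewrite gee0_abs ?lee_fin ?mulr_ge0 ?powR_ge0//.
  by rewrite ler_piMr ?powR_ge0// indicE lern1 leq_b1.
rewrite integral0 => I0.
have In0 : \forall n \near \oo, (0 <= \int[mu]_t u n t)%E.
  by apply: nearW => n; apply: integral_ge0 => t _; rewrite lee_fin mulr_ge0 ?powR_ge0.
have h0 : (0 : R) < 2^-1 by rewrite invr_gt0.
have hu : \forall n \near \oo, (\int[mu]_t u n t <= 2^-1%:E)%E.
  exact: (ge0_cvge0P _ In0).2 I0 _ h0.
apply: filterS hu => n un.
apply: ge_ereal_sup => _ [f [[mf _] f1] <-].
have [_ f2] : 0 < (2 : R) /\ (modular mu p (fun t => f t / 2)%R <= 1)%E.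
  by apply: luxemburg_norm_lt => //; apply: le_lt_trans f1 _; rewrite lte_fin ltr1n.
have mf2 : measurable_fun setT (fun t => f t / 2) by exact: measurable_funM.
have mf4 : measurable_fun setT (fun t => 2^-1 * (f t / 2)).
  exact: measurable_funM.
apply: (@le_trans _ _ e'%:E); last by rewrite lee_fin ge_min lexx.
apply: (luxemburg_norm_le e'0).
have -> : (fun t => f t * \1_(A n) t / e') =
    (fun t => 2^-1 * (f t / 2) * c * \1_(A n) t).
  have E (x y z : R) : z != 0 -> x * y / z = 2^-1 * (x / 2) * (4 / z) * y.
    by move=> z0; field.
  by apply/funext => t; apply: E; exact: lt0r_neq0 e'0.
have c0 : 0 <= c by exact: le_trans c1.
apply: le_trans (modular_young mf4 (mA n) c0) _.
have h01 : 0 <= (2^-1 : R) <= 1 by apply/andP; split; lra.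
rewrite [leRHS](_ : 1 = 2^-1%:E + 2^-1%:E)%E; last first.
  by rewrite -EFinD -[in RHS]div1r -splitr.
apply: leeD un; apply: le_trans (modularZ_le mu p_exp h01 mf2) _.
by rewrite -[leRHS]mule1; apply: lee_wpmul2l f2; rewrite lee_fin ltW.
Qed.

(** Almost every point lies in the support of at most one [f n], so the
    indicators of the supports tend to [0] and [f n] equals its own product
    with the indicator. *)
Lemma L_weakly_compact_M : L_weakly_compact mu (varL mu p) (varL mu q) id ->
  M_weakly_compact mu (varL mu p) (varL mu q) id.
Proof.
move=> Lwk f fp [M fM] fdisj.
have mf n : measurable_fun setT (f n) by case: (fp n).
pose A n := [set t | 0 < `|f n t|].
have mA n : measurable (A n) by exact: measurable_gt_abs.
have : {ae mu, forall t, (\1_(A n) t : R) @[n --> \oo] --> (0 : R)}.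
  have : {ae mu, forall t i j, i <> j -> Num.min `|f i t| `|f j t| = 0}.
    apply: ae_foralln => i; apply: ae_foralln => j.
    have [->|ij] := eqVneq i j; first exact: filterE.
    by apply: filterS (fdisj i j (elimN eqP ij)).
  apply: filterS => t tdisj; apply: cvg_near_cst.
  have [[k kt]|noA] := pselect (exists k, A k t); last first.
    apply: nearW => n; rewrite indicE memNset// => nt.
    by apply: noA; exists n.
  near=> n; rewrite indicE memNset// => nt.
  have kn : k <> n.
    by apply/eqP; rewrite lt_eqF//; near: n; exact: nbhs_infty_gt.
  by have := tdisj _ _ kn; apply/eqP; rewrite gt_eqF// lt_min kt nt.
move=> /(Lwk A mA) supA; apply/ge0_cvge0P.
  by apply: nearW => n; exact: luxemburg_norm_ge0.
move=> e e0; pose K := Num.max M 1; have K0 : 0 < K by rewrite lt_max ltr01 orbT.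
have mk n : measurable_fun setT (fun t => K^-1 * f n t) by exact: measurable_funM.
have K1 : 0 < K^-1 by rewrite invr_gt0.
have ball n : [set f | fcarrier (varL mu p) f /\ (fnorm (varL mu p) f <= 1)%E]
    (fun t => K^-1 * f n t).
  split; first split=> //.
    have [_ [s s0 fs]] := fp n; exists (K^-1 * s); first by rewrite mulr_gt0.
    rewrite (_ : (fun t => _) = (fun t => f n t / s))//.
    by apply/funext => t; field; rewrite !gt_eqF.
  have := @luxemburg_normZ_le _ _ _ mu p p_exp K^-1 K (f n) K1 (mf n).
  rewrite mulVf ?gt_eqF//; apply; apply: le_trans (fM n) _.
  by rewrite lee_fin le_max lexx.
pose S n := ereal_sup [set fnorm (varL mu q) (fun t => id g t * \1_(A n) t) |
  g in [set g | fcarrier (varL mu p) g /\ (fnorm (varL mu p) g <= 1)%E]].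
have supP : \forall n \near \oo, (0 <= S n)%E.
  apply: nearW => n; apply: le_ereal_sup_tmp.
  exists (luxemburg_norm mu q (fun t => K^-1 * f n t * \1_(A n) t)).
    by exists (fun t => K^-1 * f n t); first exact: ball.
  exact: luxemburg_norm_ge0.
have hsup : \forall n \near \oo, (S n <= (e / K)%:E)%E.
  exact: (ge0_cvge0P _ supP).2 supA _ (divr_gt0 e0 K0).
apply: filterS hsup => n supn.
have fE : f n = (fun t => K * (K^-1 * f n t * \1_(A n) t)).
  apply/funext => t; rewrite mulrA mulVKf ?gt_eqF// indicE.
  have [_|/negP] := boolP (t \in A n); first by rewrite mulr1.
  rewrite inE /A/= => /negP; rewrite -leNgt normr_le0 => /eqP ->.
  by rewrite mul0r.
rewrite /= [X in luxemburg_norm mu q X]fE -[e](divfK (lt0r_neq0 K0)) mulrC.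
apply: luxemburg_normZ_le => //.
  apply: measurable_funM => //; exact: measurable_indic.
apply: le_trans supn; apply: ereal_sup_ubound.
by exists (fun t => K^-1 * f n t); first exact: ball.
Unshelve. all: by end_near. Qed.

End inclusion.

(** * Normalized indicators and disjoint strict singularity *)

Section spans.
Context d (T : measurableType d) (R : realType).
Variables (mu : {finite_measure set T -> \bar R}) (p : T -> R).
Hypothesis p_exp : exponent p.

Let mp : measurable_fun setT p. Proof. by case: p_exp. Qed.

Lemma modular0 : modular mu p (fun=> 0) = 0%E.
Proof.
rewrite /modular; under eq_integral.
  by move=> t _; rewrite normr0 powR0 ?gt_eqF// ?exponent_gt0//; over.
by rewrite integral0.
Qed.

Lemma luxemburg_norm0 : luxemburg_norm mu p (fun=> 0) = 0%E.
Proof.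
apply/eqP; rewrite eq_le luxemburg_norm_ge0 andbT.
apply: luxemburg_norm_le_above => s s0; apply: luxemburg_norm_le => //.
by rewrite (_ : (fun t => _) = fun=> 0) ?modular0//; apply/funext => t; rewrite mul0r.
Qed.

Lemma closed_span_mem (f : nat -> T -> R) (n : nat) :
  fcarrier (varL mu p) (f n) -> closed_span (varL mu p) f (f n).
Proof.
move=> fn; split=> // e e0; exists n.+1, (fun i => (i == n)%:R).
rewrite /= (_ : (fun t => _) = fun=> 0) ?luxemburg_norm0//.
apply/funext => t; rewrite (bigD1 ord_max)//= eqxx mul1r big1 ?addr0 ?subrr//.
by move=> i; rewrite -val_eqE/= => /negbTE ->; rewrite mul0r.
Qed.

Variable A : set T.
Hypotheses (mA : measurable A) (A0 : (0 < mu A)%E).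

Lemma fine_mu_gt0 : 0 < fine (mu A).
Proof. by apply: fine_gt0; rewrite A0/= -ge0_fin_numE// fin_num_measure. Qed.

Lemma measurable_normalized_indic : measurable_fun setT (normalized_indic mu p A).
Proof.
apply: measurable_funM; first exact: measurable_indic.
apply: measurable_fun_powR => //; apply: measurableT_comp => //.
exact: measurable_fun_inv.
Qed.

Lemma modular_normalized_indic : modular mu p (normalized_indic mu p A) = 1%E.
Proof.
have v0 := fine_mu_gt0.
rewrite /modular (eq_integral (fun t => ((fine (mu A))^-1%:E * (\1_A t)%:E)%E)).
  rewrite ge0_integralZl//; last 2 first.
  - by apply/measurable_EFinP; exact: measurable_indic.
  - by rewrite lee_fin invr_ge0 ltW.
  by rewrite integral_indic// setIT [X in (_ * X)%E]measure_fin// -EFinM mulVf ?gt_eqF.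
move=> t _; rewrite /normalized_indic indicE -EFinM; congr EFin.
have p0 := exponent_gt0 p_exp t.
case: (t \in A); rewrite ?mul0r ?mul1r ?mulr1 ?mulr0; last first.
  by rewrite normr0 powR0// gt_eqF.
rewrite ger0_norm ?powR_ge0// -powRrM mulNr mulVf ?gt_eqF//.
by rewrite powR_inv1// ltW.
Qed.

Lemma normalized_indic_carrier : fcarrier (varL mu p) (normalized_indic mu p A).
Proof.
split; first exact: measurable_normalized_indic.
exists 1 => //; rewrite (_ : (fun t => _) = normalized_indic mu p A).
  by rewrite modular_normalized_indic ltry.
by apply/funext => t; rewrite divr1.
Qed.

(** The modular is [1], and by [modularZ_le] it would be less than [1] if the
    norm were. *)
Lemma luxemburg_norm_normalized_indic :
  luxemburg_norm mu p (normalized_indic mu p A) = 1%E.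
Proof.
have mf := measurable_normalized_indic; set f := normalized_indic mu p A in mf *.
have f1 : modular mu p f = 1%E by exact: modular_normalized_indic.
apply/eqP; rewrite eq_le; apply/andP; split.
  apply: luxemburg_norm_le => //; rewrite (_ : (fun t => _) = f) ?f1//.
  by apply/funext => t; rewrite divr1.
apply: le_ereal_inf_tmp => _ [s [s0 fs] <-]; rewrite lee_fin leNgt.
apply/negP => s1; have s01 : 0 <= s <= 1 by rewrite !ltW.
have mfs : measurable_fun setT (fun t => f t / s) by exact: measurable_funM.
have := modularZ_le mu p_exp s01 mfs.
rewrite (_ : (fun t => s * (f t / s)) = f) ?f1; last first.
  by apply/funext => t; rewrite mulrC divfK// gt_eqF.
rewrite leNgt => /negP; apply; apply: (@le_lt_trans _ _ s%:E).
  by rewrite -[leRHS]mule1; apply: lee_wpmul2l fs; rewrite lee_fin ltW.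
by rewrite lte_fin.
Qed.

End spans.

Section singular.
Context d (T : measurableType d) (R : realType).
Variables (mu : {finite_measure set T -> \bar R}) (p q : T -> R).
Hypotheses (p_exp : exponent p) (q_exp : exponent q).

Lemma M_weakly_compact_DSS : M_weakly_compact mu (varL mu p) (varL mu q) id ->
  disjointly_strictly_singular mu (varL mu p) (varL mu q) id.
Proof.
move=> Mwk [f [fp f1 fdisj [c c0 fc]]].
have fle1 : exists M : R, forall n, (fnorm (varL mu p) (f n) <= M%:E)%E.
  by exists 1 => n; rewrite f1.
have norm0 : \forall n \near \oo, (0 <= fnorm (varL mu q) (id (f n)))%E.
  by apply: nearW => n; exact: luxemburg_norm_ge0.
have c20 : 0 < c / 2 by rewrite divr_gt0.
have [n _ /(_ n (leqnn n))/=] :=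
  (ge0_cvge0P _ norm0).2 (Mwk f fp fle1 fdisj) _ c20.
apply/negP; rewrite -ltNge.
apply: lt_le_trans (fc _ (closed_span_mem p_exp (fp n))).
by rewrite f1 mule1 lte_fin ltr_pdivrMr// ltr_pMr// ltr1n.
Qed.

Lemma DSS_normalized_indic :
  disjointly_strictly_singular mu (varL mu p) (varL mu q) id ->
  forall E : nat -> set T, (forall n, measurable (E n)) ->
    (forall n, (0 < mu (E n))%E) -> trivIset setT E ->
    ~ isomorphism_on (varL mu p) (varL mu q) id
        (closed_span (varL mu p) (fun n => normalized_indic mu p (E n))).
Proof.
move=> dss E mE E0 tE iso; apply: dss.
exists (fun n => normalized_indic mu p (E n)); split=> //.
- by move=> n; exact: normalized_indic_carrier.
- by move=> n; exact: luxemburg_norm_normalized_indic.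
move=> i j ij; apply: filterE => t; rewrite /normalized_indic.
have [it|it] := pselect (E i t); last first.
  by rewrite indicE memNset// mul0r normr0 min_l.
rewrite [X in Num.min _ `|X * _|]indicE memNset => [|jt].
  by rewrite mul0r normr0 min_r.
by apply: ij; apply: tE => //; exists t.
Qed.

End singular.

(** * Isomorphic copies when the exponential tail fails *)

(** Failure of the exponential tail at some [a] provides levels [s_0 < s_1 < ...]
    with [mu (|f| > s_k) > a ^ - s_k], spaced so that the level set of [s_k.+1]
    takes at most half of that measure.  The layers between consecutive levels
    are then disjoint and still of measure at least [a ^ - s_k / 2]. *)
Lemma not_exp_tail_layers d (T : measurableType d) (R : realType)
    (mu : {finite_measure set T -> \bar R}) (f : T -> R) :
  measurable_fun setT f -> ~ exp_tail mu f ->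
  exists2 a : R, 1 < a & exists (E : nat -> set T) (s : nat -> R),
    [/\ trivIset setT E, forall n, measurable (E n), forall n, 0 <= s n,
        forall n, E n `<=` [set t | s n < `|f t|] &
        forall n, a `^ (- s n) / 2 <= fine (mu (E n))].
Proof.
move=> mf ntail.
have [a [a1 ha]] : exists a : R, 1 < a /\ forall C : R, 0 <= C ->
    exists2 s : R, 0 <= s & C * a `^ (- s) < fine (distribution_fun mu f s).
  apply: contrapT => na; apply: ntail => a a1; apply: contrapT => nC.
  apply: na; exists a; split=> // C C0; apply: contrapT => ns; apply: nC.
  exists C => // s s0; rewrite leNgt; apply/negP => sC; apply: ns; exists s => //.
  by rewrite -lte_fin -measure_fin//; exact: measurable_gt_abs.
have a0 : 0 < a by exact: lt_trans a1.
set m := fine (mu setT); have m0 : 0 <= m by rewrite fine_ge0.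
pose A (s : R) := [set t | s < `|f t|].
have mA s : measurable (A s) by exact: measurable_gt_abs.
have Am s : fine (mu (A s)) <= m.
  by rewrite -lee_fin -!measure_fin// le_measure ?inE.
have small (e : R) : 0 < e -> exists N : nat, (mu (A N%:R) <= e%:E)%E.
  move=> e0.
  have cap0 : \bigcap_n A n%:R = set0.
    rewrite -subset0 => t /(_ (Num.truncn `|f t|).+1 I); rewrite /A/=.
    by apply/negP; rewrite -leNgt ltW// truncnS_gt.
  have := @nonincreasing_cvg_mu _ _ _ mu (fun n => A n%:R).
  rewrite cap0 measure0 => Acvg.
  have mu0 : \forall n \near \oo, (0 <= (mu \o (fun n => A n%:R)) n)%E.
    exact: nearW.
  have [||||n _ /(_ n (leqnn n))] := (ge0_cvge0P _ mu0).2 (Acvg _ _ _ _) _ e0.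
  - by rewrite -ge0_fin_numE// fin_num_measure.
  - by [].
  - exact: measurable0.
  - move=> i j ij; apply/subsetPset => t; rewrite /A/=; apply: le_lt_trans.
    by rewrite ler_nat.
  by exists n.
have next (s : R) : exists s' : R, [/\ 0 <= s',
    a `^ (- s') < fine (mu (A s')), s < s' & (mu (A s') <= (a `^ (- s) / 2)%:E)%E].
  have [N hN] := small (a `^ (- s) / 2) (divr_gt0 (powR_gt0 _ a0) (ltr0Sn R 1)).
  (* the first summand of [C] forces [s' > M], since the measure is at most [m];
     the summand [1] keeps [a ^ - s'] below the measure *)
  pose M := Num.max N%:R s; pose C := a `^ M * (1 + m) + 1.
  have aM0 : 0 < a `^ M by rewrite powR_gt0.
  have C0 : 0 <= C by rewrite addr_ge0// mulr_ge0 ?addr_ge0// ltW.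
  have [s' s'0 hs'] := ha C C0.
  have as' : 0 < a `^ (- s') by rewrite powR_gt0.
  have Ms' : M < s'.
    rewrite ltNge; apply/negP => s'M; have := lt_le_trans hs' (Am s').
    apply/negP; rewrite -leNgt.
    have : 1 <= a `^ M * a `^ (- s').
      rewrite -powRD; last by rewrite (gt_eqF a0) implybT.
      by rewrite -[leLHS](powRr0 a); apply: ler_powR; rewrite ?subr_ge0// ltW.
    rewrite /C mulrDl mul1r mulrAC => h1.
    apply: (@le_trans _ _ (1 * (1 + m))); first by rewrite mul1r lerDr.
    apply: le_trans (ler_wpM2r _ h1) _; first by rewrite addr_ge0.
    by rewrite lerDl ltW.
  exists s'; split=> //.
  - apply: le_lt_trans hs'; rewrite ler_peMl ?(ltW as')// lerDr.
    by rewrite mulr_ge0 ?addr_ge0// ltW.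
  - by apply: le_lt_trans Ms'; rewrite le_max lexx orbT.
  apply: le_trans hN; apply: le_distribution_fun => //.
  by rewrite ltW// (le_lt_trans _ Ms')// le_max lexx.
have [step hstep] := choice next.
pose s n := iter n.+1 step 0.
have s0 n : 0 <= s n by have [] := hstep (iter n step 0).
have smu n : a `^ (- s n) < fine (mu (A (s n))).
  by have [] := hstep (iter n step 0).
have sS n : s n < s n.+1 by have [] := hstep (s n).
have smuS n : (mu (A (s n.+1)) <= (a `^ (- s n) / 2)%:E)%E.
  by have [] := hstep (s n).
have s_mono i j : (i <= j)%N -> s i <= s j.
  by apply: (iffLR (@nondecreasing_seqP _ _ s)) => n; rewrite ltW.
exists a => //; exists (fun n => A (s n) `\` A (s n.+1)), s; split=> //.
- apply: ltn_trivIset => j i ij; rewrite -subset0 => t [[_ it] [jt _]]; apply: it.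
  by rewrite /A/=; apply: le_lt_trans jt; exact: s_mono.
- by move=> n; exact: measurableD.
move=> n; have AS : A (s n.+1) `<=` A (s n).
  by move=> t; rewrite /A/=; apply: lt_trans.
have -> : fine (mu (A (s n) `\` A (s n.+1))) =
    fine (mu (A (s n))) - fine (mu (A (s n.+1))).
  rewrite measureD//; last by rewrite -ge0_fin_numE// fin_num_measure.
  by rewrite setIidr// fineB// fin_num_measure.
have := smuS n; rewrite measure_fin// lee_fin => h.
by rewrite lerBrDr (le_trans (lerD (lexx _) h))// -splitr ltW.
Qed.

Section lower_bound.
Context d (T : measurableType d) (R : realType).
Variables (mu : {finite_measure set T -> \bar R}) (p q : T -> R).
Hypotheses (p_exp : exponent p) (q_exp : exponent q).
Hypothesis q_lt_p : {ae mu, forall t, q t < p t}.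

Variables (E : nat -> set T) (c : R).
Hypotheses (mE : forall n, measurable (E n)) (E0 : forall n, (0 < mu (E n))%E).
Hypotheses (tE : trivIset setT E) (c0 : 0 < c).
Hypothesis cE : forall n, {ae mu, forall t, E n t ->
  c <= fine (mu (E n)) `^ ((q t)^-1 - (p t)^-1)}.

Let mp : measurable_fun setT p. Proof. by case: p_exp. Qed.
Let mq : measurable_fun setT q. Proof. by case: q_exp. Qed.

Let v n := fine (mu (E n)).
Let v0 n : 0 < v n. Proof. exact: fine_mu_gt0. Qed.

Let comb (n : nat) (a : nat -> R) (t : T) : R :=
  \sum_(i < n) a i * normalized_indic mu p (E i) t.

Let measurable_comb (n : nat) (a : nat -> R) : measurable_fun setT (comb n a).
Proof.
apply: measurable_sum => i; apply: measurable_funM => //.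
exact: measurable_normalized_indic.
Qed.

Let comb_on (n : nat) (a : nat -> R) (i : nat) t : (i < n)%N -> E i t ->
  comb n a t = a i * v i `^ (- (p t)^-1).
Proof.
move=> ltin it; rewrite /comb (bigD1 (Ordinal ltin))//= big1 ?addr0.
  by rewrite /normalized_indic indicE mem_set// mul1r.
move=> j; rewrite -val_eqE/= => ji; rewrite /normalized_indic indicE memNset.
  by rewrite mul0r mulr0.
by move=> jt; move/eqP: ji; apply; apply: tE => //; exists t.
Qed.

Let comb_off (n : nat) (a : nat -> R) t : (forall i, (i < n)%N -> ~ E i t) ->
  comb n a t = 0.
Proof.
move=> nt; rewrite /comb big1// => i _; rewrite /normalized_indic indicE memNset.
  by rewrite mul0r mulr0.
exact: nt.
Qed.

(** On [E i] the block is [mu(E i) ^ (- 1 / p) >= c * mu(E i) ^ (- 1 / q)], so it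
    is at least [c] times the block normalized for [q]. *)
Let comb_powR_ge (n : nat) (a : nat -> R) (l : R) : 0 < l ->
  {ae mu, forall t i, (i < n)%N -> E i t ->
    (`|a i| / l) `^ q t / v i <= `|comb n a t / (c * l)| `^ q t}.
Proof.
move=> l0; apply: filterS (ae_foralln cE) => t ct i ltin it.
rewrite (comb_on a ltin it).
have q0 := exponent_gt0 q_exp t.
have -> : `|a i * v i `^ (- (p t)^-1) / (c * l)| =
    (`|a i| / l) * (v i `^ (- (p t)^-1) / c).
  rewrite !normrM normfV (ger0_norm (powR_ge0 _ _)) (gtr0_norm (mulr_gt0 c0 l0)).
  by field; rewrite !gt_eqF.
have al0 : 0 <= `|a i| / l by rewrite divr_ge0// ltW.
rewrite [leRHS]powRM ?divr_ge0 ?powR_ge0 ?(ltW c0) ?(ltW l0)//; apply: ler_wpM2l.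
  exact: powR_ge0.
have -> : (v i)^-1 = (v i `^ (- (q t)^-1)) `^ q t.
  by rewrite -powRrM mulNr mulVf ?gt_eqF// powR_inv1// ltW.
apply: (ge0_ler_powR (ltW q0)); rewrite ?nnegrE ?divr_ge0 ?powR_ge0 ?(ltW c0)//.
rewrite ler_pdivlMr//; apply: le_trans (ler_wpM2l (powR_ge0 _ _) (ct i it)) _.
rewrite -powRD; last by rewrite (gt_eqF (v0 i)) implybT.
by rewrite addKr.
Qed.

(** A coefficient above [l] would make the integrand exceed [1 / mu(E i)] on all
    of [E i], hence the modular exceed [1]. *)
Let coef_le (n : nat) (a : nat -> R) (l : R) (i : nat) : 0 < l -> (i < n)%N ->
  (modular mu q (fun t => comb n a t / (c * l))%R <= 1)%E -> `|a i| <= l.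
Proof.
move=> l0 ltin; apply: contraTT; rewrite -ltNge => la.
have k1 : 1 < `|a i| / l by rewrite ltr_pdivlMr// mul1r.
rewrite -ltNge; apply: (@lt_le_trans _ _ (`|a i| / l)%:E); first by rewrite lte_fin.
have -> : ((`|a i| / l)%:E =
    \int[mu]_t (((`|a i| / l) / v i)%:E * (\1_(E i) t)%:E))%E.
  rewrite ge0_integralZl//; last 2 first.
  - by apply/measurable_EFinP; exact: measurable_indic.
  - by rewrite lee_fin !divr_ge0// ltW.
  rewrite integral_indic// setIT [X in (_ * X)%E]measure_fin// -EFinM divfK//.
  by rewrite gt_eqF.
apply: ae_ge0_le_integral => //.
- by move=> t _; rewrite -EFinM lee_fin mulr_ge0// !divr_ge0// ltW.
- by apply/measurable_EFinP; apply: measurable_funM => //; exact: measurable_indic.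
- by apply: measurable_modular => //; exact: measurable_funM.
apply: filterS (comb_powR_ge n a l0) => t ht _; rewrite -EFinM lee_fin indicE.
have [/set_mem it|_] := boolP (t \in E i); last by rewrite mulr0 powR_ge0.
rewrite mulr1; apply: le_trans (ht _ ltin it); apply: ler_wpM2r.
  by rewrite invr_ge0 ltW.
by apply: le1r_powR; [exact: ltW|case: q_exp].
Qed.

(** Once the coefficients are at most [l], [q <= p] gives
    [(|a_i| / l) ^ p <= (|a_i| / l) ^ q], so the modular for [p] is controlled
    by the one for [q]. *)
Let comb_norm_le (n : nat) (a : nat -> R) (l : R) : 0 < l ->
  (luxemburg_norm mu q (comb n a) < (c * l)%:E)%E ->
  (luxemburg_norm mu p (comb n a) <= l%:E)%E.
Proof.
move=> l0 /(luxemburg_norm_lt q_exp (measurable_comb n a))[_ hq].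
have al i : (i < n)%N -> `|a i| <= l by move=> ltin; exact: coef_le hq.
apply: (luxemburg_norm_le l0); apply: le_trans hq.
have mcomb (k : R) : measurable_fun setT (fun t => comb n a t / k).
  exact: measurable_funM.
apply: ae_ge0_le_integral => //.
- exact: measurable_modular.
- exact: measurable_modular.
apply: filterS2 q_lt_p (comb_powR_ge n a l0) => t qp ht _; rewrite lee_fin.
have p0 := exponent_gt0 p_exp t; have q0 := exponent_gt0 q_exp t.
have [[i [ltin it]]|nt] := pselect (exists i, (i < n)%N /\ E i t); last first.
  rewrite comb_off ?mul0r ?normr0 ?powR0 ?gt_eqF// => i ltin it.
  by apply: nt; exists i.
apply: le_trans (ht _ ltin it); rewrite (comb_on a ltin it).
have -> : `|a i * v i `^ (- (p t)^-1) / l| = (`|a i| / l) * v i `^ (- (p t)^-1).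
  rewrite !normrM normfV (ger0_norm (powR_ge0 _ _)) (gtr0_norm l0).
  by rewrite mulrAC.
have al0 : 0 <= `|a i| / l by rewrite divr_ge0// ltW.
rewrite [leLHS]powRM ?powR_ge0//.
have -> : (v i `^ (- (p t)^-1)) `^ p t = (v i)^-1.
  by rewrite -powRrM mulNr mulVf ?gt_eqF// powR_inv1// ltW.
apply: ler_wpM2r; first by rewrite invr_ge0 ltW.
have [->|aln0] := eqVneq (`|a i| / l) 0; first by rewrite !powR0 ?gt_eqF.
apply: ger_powR; last exact: ltW.
by rewrite lt0r aln0 al0/= ler_pdivrMr// mul1r al.
Qed.

(** The estimate passes from finite combinations to the closed span because the
    inclusion is bounded. *)
Lemma isomorphism_normalized_indic :
  isomorphism_on (varL mu p) (varL mu q) id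
    (closed_span (varL mu p) (fun n => normalized_indic mu p (E n))).
Proof.
set K := 1 + fine (mu setT); have K0 : 0 < K.
  by rewrite ltr_pwDl// fine_ge0.
(* With [|g|_q < l] and [h] a finite combination close to [g], two uses of the
   quasi-triangle inequality give [|h|_q <= 4 l] and then
   [|g|_p <= 4 * (6 l / c)]. *)
exists (c / 24); first by rewrite divr_gt0.
move=> g [[mg _] gapprox]; apply: lee_fin_above => [|l gl].
  by apply: lt_le_trans (luxemburg_norm_ge0 mu q g); rewrite ltNyr.
have [l0 _] := luxemburg_norm_lt q_exp mg gl.
pose e := Num.min (l / (2 * K)) (l / c).
have e0 : 0 < e by rewrite lt_min !divr_gt0// mulr_gt0.
have [n [a ha]] := gapprox e e0.
pose h := comb n a.
have {}ha : (luxemburg_norm mu p (fun t => g t - h t)%R < e%:E)%E by exact: ha.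
have mh : measurable_fun setT h by exact: measurable_comb.
have mgh : measurable_fun setT (fun t => g t - h t) by exact: measurable_funB.
have mhg : measurable_fun setT (fun t => h t - g t) by exact: measurable_funB.
have ghq : (luxemburg_norm mu q (fun t => h t - g t)%R < l%:E)%E.
  apply: (@le_lt_trans _ _ (luxemburg_norm mu q (fun t => g t - h t)%R)).
    by apply: le_luxemburg_norm => //; apply: filterE => t; rewrite distrC.
  apply: le_lt_trans (luxemburg_norm_inclusion p_exp q_exp q_lt_p mgh ha) _.
  rewrite lte_fin -/K; apply: (@le_lt_trans _ _ (K * (l / (2 * K)))).
    by rewrite ler_pM2l// ge_min lexx.
  have -> : K * (l / (2 * K)) = l / 2 by field; rewrite gt_eqF.
  by rewrite ltr_pdivrMr// ltr_pMr// ltr1n.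
have hq : (luxemburg_norm mu q h < (c * (5 * l / c))%:E)%E.
  rewrite (_ : h = fun t => g t + (h t - g t)); last first.
    by apply/funext => t; rewrite addrC subrK.
  apply: le_lt_trans (luxemburg_normD_le q_exp mg mhg gl ghq) _.
  have -> : c * (5 * l / c) = 5 * l by field; rewrite gt_eqF.
  by rewrite lte_fin ltr_pM2r// ltr_nat.
have hp : (luxemburg_norm mu p h < (6 * l / c)%:E)%E.
  apply: le_lt_trans (comb_norm_le _ hq) _; first by rewrite divr_gt0 ?mulr_gt0.
  by rewrite lte_fin ltr_pM2r ?invr_gt0// ltr_pM2r// ltr_nat.
have ghp : (luxemburg_norm mu p (fun t => g t - h t)%R < (6 * l / c)%:E)%E.
  apply: lt_le_trans ha _; rewrite lee_fin /e ge_min; apply/orP; right.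
  rewrite ler_pM2r ?invr_gt0// ler_peMl ?ler1n// ltW//.
have := luxemburg_normD_le p_exp mh mgh hp ghp.
rewrite (_ : (fun t => h t + (g t - h t)) = g); last first.
  by apply/funext => t; rewrite addrC subrK.
have -> : 4 * (6 * l / c) = (c / 24)^-1 * l by field; rewrite gt_eqF.
by rewrite EFinM lee_pdivlMl// divr_gt0.
Qed.

End lower_bound.

(** On the layer [E n], [r] is above [s n] and at least [1], so
    [mu(E n) ^ (1 / r) >= (a ^ - s n / 2) ^ (1 / r) >= a ^ - 1 / 2]: the blocks
    normalized for [p] and for [q] are comparable. *)
Lemma normalized_indic_exp_tail d (T : measurableType d) (R : realType)
    (mu : {finite_measure set T -> \bar R}) (p q : T -> R) :
  exponent p -> exponent q -> {ae mu, forall t, q t < p t} ->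
  (forall E : nat -> set T, (forall n, measurable (E n)) ->
    (forall n, (0 < mu (E n))%E) -> trivIset setT E ->
    ~ isomorphism_on (varL mu p) (varL mu q) id
        (closed_span (varL mu p) (fun n => normalized_indic mu p (E n)))) ->
  exp_tail mu (fun t => p t * q t / (p t - q t)).
Proof.
move=> p_exp q_exp q_lt_p noiso; apply: contrapT => ntail.
have [[mp p1] [mq q1]] := (p_exp, q_exp).
have [a a1 [E [s [tE mE s0 Es muE]]]] :=
  not_exp_tail_layers (measurable_holder_exponent p_exp q_exp) ntail.
have a0 : 0 < a by exact: lt_trans a1.
have as0 n : 0 < a `^ (- s n) by rewrite powR_gt0.
have v0 n : 0 < fine (mu (E n)) by apply: lt_le_trans (muE n); rewrite divr_gt0.
have E0 n : (0 < mu (E n))%E by rewrite measure_fin// lte_fin.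
have c0 : 0 < a^-1 / 2 by rewrite divr_gt0// invr_gt0.
apply: (noiso E mE E0 tE).
apply: (isomorphism_normalized_indic p_exp q_exp q_lt_p mE E0 tE c0) => n.
apply: filterS q_lt_p => t qp /Es/=.
have p0 := exponent_gt0 p_exp t; have q0 := exponent_gt0 q_exp t.
have pq0 : 0 < p t - q t by rewrite subr_gt0.
set r := p t * q t / (p t - q t); have r0 : 0 < r by rewrite divr_gt0 ?mulr_gt0.
rewrite gtr0_norm// => sr.
have -> : (q t)^-1 - (p t)^-1 = r^-1 by rewrite /r; field; rewrite !gt_eqF.
have r1 : r^-1 <= 1.
  rewrite invf_le1// ler_pdivlMr// mul1r (le_trans (_ : _ <= p t))//.
    by rewrite gerBl ltW.
  by rewrite ler_peMr// ltW.
apply: (@le_trans _ _ ((a `^ (- s n) / 2) `^ r^-1)); last first.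
  apply: ge0_ler_powR (muE n); rewrite ?nnegrE ?(ltW (v0 n))//.
    by rewrite invr_ge0 ltW.
  by rewrite divr_ge0// ltW.
rewrite [leRHS]powRM//; last exact: ltW.
apply: ler_pM; [by rewrite invr_ge0 ltW|by []| |].
  rewrite -powRrM -powR_inv1 ?(ltW a0)//; apply: ler_powR; first exact: ltW.
  by rewrite mulNr lerN2 ler_pdivrMr// mul1r ltW.
by apply: ger1_powR => //; apply/andP; split; lra.
Qed.

(** * The equivalence *)

Theorem theorem4p8 (R : realType) (d : measure_display) (T : measurableType d)
    (mu : {finite_measure set T -> \bar R}) (p q : T -> R)
    (mu_atomless : atomless mu)
    (p_exp : exponent p) (q_exp : exponent q)
    (q_lt_p : {ae mu, forall t, q t < p t}) :
  let m := fine (mu setT) in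
  let Lp := varL mu p in
  let Lq := varL mu q in
  [<-> (* (1) *)
       forall a : R, 1 < a ->
         (\int[lebesgue_measure]_(x in `[0%R, m[)
            powRe a (rearrangement mu
                       (fun t => p t * q t / (p t - q t))%R x) < +oo)%E;
       (* (2) *)
       L_weakly_compact mu Lp Lq id;
       (* (3) *)
       M_weakly_compact mu Lp Lq id;
       (* (4) *)
       disjointly_strictly_singular mu Lp Lq id;
       (* (5) *)
       forall E : nat -> set T,
         (forall n, measurable (E n)) ->
         (forall n, (0 < mu (E n))%E) ->
         trivIset setT E ->
         ~ isomorphism_on Lp Lq id
             (closed_span Lp (fun n => normalized_indic mu p (E n)));
       (* (6) *)
       powRe (m - x) (rearrangement mu
                        (fun t => (p t - q t) / (p t * q t)) x)
         @[x --> m^'-] --> 0%E].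
Proof.
move=> m Lp Lq.
have mr := measurable_holder_exponent p_exp q_exp.
have gr t : (p t - q t) / (p t * q t) = (p t * q t / (p t - q t))^-1.
  by rewrite invf_div.
have r_neq0 : {ae mu, forall t, p t * q t / (p t - q t) != 0}.
  by apply: filterS (holder_exponent_gt0 p_exp q_exp q_lt_p) => t /lt0r_neq0.
tfae.
- move=> /(rearrangement_exp_tail mr).
  exact: exp_tail_L_weakly_compact.
- exact: L_weakly_compact_M.
- exact: M_weakly_compact_DSS.
- exact: DSS_normalized_indic.
- move=> /(normalized_indic_exp_tail p_exp q_exp q_lt_p).
  exact: exp_tail_reciprocal.
- move=> /(reciprocal_exp_tail mr gr) tail a.
  exact: exp_tail_rearrangement.
Qed.
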